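(* Let $n$ be a positive integer and let $R$ be a nonzero ring. If $R$ is a von Neumann regular ring, then $MC_n(R)$ is a von Neumann regular ring.
   Context: All rings are associative with $1$. A ring $R$ is von Neumann regular if for every $a\in R$ there is $x\in R$ with $a=axa$. $M_m(R)$ is the ring of $m\times m$ matrices over $R$. Identify $M_n(M_{n^k}(R))$ with $M_{n^{k+1}}(R)$ via block matrices. The $n$-matricial closure $MC_n(R)$ is the direct limit of the rings $M_{n^k}(R)$, $k\in\mathbb{N}=\{0,1,2,\dots\}$ (with $M_{n^0}(R)=R$), along the injective ring morphisms $M_{n^k}(R)\to M_{n^{k+1}}(R)$ sending $A$ to the block diagonal matrix with $n$ diagonal blocks equal to $A$. *)

(* Defs.v *)
From HB Require Import structures.
From mathcomp Require Import all_boot all_order all_algebra.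
From mathcomp Require Import boolp.

Set Implicit Arguments.
Unset Strict Implicit.
Unset Printing Implicit Defensive.

Import GRing.Theory.
Local Open Scope ring_scope.
Local Open Scope quotient_scope.

Definition von_neumann_regular (R : pzRingType) : Prop :=
  forall a : R, exists x : R, a = a * x * a.

Lemma leqS_or k N : (k <= N.+1)%N -> (k <= N)%N \/ k = N.+1.
Proof. by rewrite leq_eqVlt ltnS => /orP[/eqP|]; [right | left]. Qed.

(* The direct limit of A 0 -> A 1 -> A 2 -> ..., as the quotient of the
   disjoint union {k & A k} by eventual equality. *)
Section DirectLimit.
Variables (A : nat -> pzRingType) (f : forall k, {rmorphism A k -> A k.+1}).

Fixpoint dl_iter d k (a : A k) : A (d + k)%N :=
  if d is d'.+1 then f (d' + k)%N (dl_iter d' a) else a.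

(* The transition map A k -> A N; the cast only replaces N - k + k by N. *)
Definition dl_map k N (le_kN : (k <= N)%N) (a : A k) : A N :=
  ecast m (A m) (subnK le_kN) (dl_iter (N - k) a).

Lemma dl_mapE d k (le_kN : (k <= d + k)%N) (a : A k) :
  dl_map le_kN a = dl_iter d a.
Proof.
by rewrite /dl_map; move: (subnK le_kN); rewrite addnK => e; rewrite eq_axiomK.
Qed.

Lemma dl_map_id k (le_kk : (k <= k)%N) (a : A k) : dl_map le_kk a = a.
Proof. exact: (@dl_mapE 0). Qed.

Lemma dl_mapS k N (le_kN : (k <= N)%N) (le_kN1 : (k <= N.+1)%N) (a : A k) :
  dl_map le_kN1 a = f N (dl_map le_kN a).
Proof.
have [d defN] : exists d, N = (d + k)%N by exists (N - k)%N; rewrite subnK.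
by subst N; rewrite dl_mapE (@dl_mapE d.+1).
Qed.

Lemma dl_map_comp k l m (kl : (k <= l)%N) (lm : (l <= m)%N) (km : (k <= m)%N)
  (a : A k) : dl_map lm (dl_map kl a) = dl_map km a.
Proof.
elim: m => [|m IHm] in lm km *.
  have l0 : l = 0%N by case: l lm {kl}.
  by subst l; rewrite dl_map_id; congr dl_map; apply: bool_irrelevance.
have [lt_lm|defl] := leqS_or lm.
  rewrite (@dl_mapS _ m lt_lm) (@dl_mapS _ m (leq_trans kl lt_lm)).
  by congr (f m _); apply: IHm.
by subst l; rewrite dl_map_id; congr dl_map; apply: bool_irrelevance.
Qed.

Lemma dl_map_is_zmod k N (le_kN : (k <= N)%N) : zmod_morphism (dl_map le_kN).
Proof.
elim: N => [|N IHN] in le_kN *.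
  have k0 : k = 0%N by case: k le_kN.
  by subst k => a b; rewrite !dl_map_id.
have [lt_kN|defk] := leqS_or le_kN => [] a b.
  by rewrite !(@dl_mapS _ N lt_kN) IHN rmorphB.
by subst k; rewrite !dl_map_id.
Qed.

Lemma dl_map_is_monoid k N (le_kN : (k <= N)%N) :
  monoid_morphism (dl_map le_kN).
Proof.
elim: N => [|N IHN] in le_kN *.
  have k0 : k = 0%N by case: k le_kN.
  by subst k; split=> [|a b]; rewrite !dl_map_id.
have [lt_kN|defk] := leqS_or le_kN.
  have [IH1 IHM] := IHN lt_kN.
  by split=> [|a b]; rewrite !(@dl_mapS _ N lt_kN) ?IH1 ?IHM ?rmorph1 ?rmorphM.
by subst k; split=> [|a b]; rewrite !dl_map_id.
Qed.

HB.instance Definition _ k N (le_kN : (k <= N)%N) :=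
  GRing.isZmodMorphism.Build (A k) (A N) (dl_map le_kN) (dl_map_is_zmod le_kN).
HB.instance Definition _ k N (le_kN : (k <= N)%N) :=
  GRing.isMonoidMorphism.Build (A k) (A N) (dl_map le_kN)
    (dl_map_is_monoid le_kN).

Definition dl_rel (x y : {k & A k}) : bool :=
  `[< exists N (xN : (tag x <= N)%N) (yN : (tag y <= N)%N),
        dl_map xN (tagged x) = dl_map yN (tagged y) >].

Lemma dl_rel_refl : reflexive dl_rel.
Proof. by move=> x; apply/asboolP; exists (tag x), (leqnn _), (leqnn _). Qed.

Lemma dl_rel_sym : symmetric dl_rel.
Proof.
by move=> x y; apply/asboolP/asboolP => -[N [p [q e]]]; exists N, q, p.
Qed.

Lemma dl_rel_trans : transitive dl_rel.
Proof.
move=> y x z /asboolP[M [xM [yM eM]]] /asboolP[N [yN [zN eN]]].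
apply/asboolP; exists (maxn M N).
have [hM hN] := (leq_maxl M N, leq_maxr M N).
exists (leq_trans xM hM), (leq_trans zN hN).
rewrite -(dl_map_comp xM hM) eM -(dl_map_comp zN hN) -eN.
by rewrite (dl_map_comp _ _ (leq_trans yM hM)) (dl_map_comp _ _ (leq_trans yM hM)).
Qed.

Canonical dl_equiv := EquivRel dl_rel dl_rel_refl dl_rel_sym dl_rel_trans.

Definition dirlim := {eq_quot dl_equiv}.
HB.instance Definition _ := Choice.on dirlim.

Definition dirlim_in k (a : A k) : dirlim := (\pi_dirlim (Tagged A a)).

Lemma dirlim_in_eq k l (a : A k) (b : A l) :
  dirlim_in a = dirlim_in b <->
  exists N (kN : (k <= N)%N) (lN : (l <= N)%N), dl_map kN a = dl_map lN b.
Proof.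
split=> [/eqmodP/asboolP //|h].
by apply/eqmodP/asboolP.
Qed.

Lemma dirlim_in_map k N (le_kN : (k <= N)%N) (a : A k) :
  dirlim_in (dl_map le_kN a) = dirlim_in a.
Proof.
by apply/dirlim_in_eq; exists N, (leqnn N), le_kN; rewrite dl_map_id.
Qed.

Lemma dirlim_in_step k (a : A k) : dirlim_in (f k a) = dirlim_in a.
Proof.
by rewrite -(dirlim_in_map (leqnSn k)) (dl_mapS (leqnn k)) dl_map_id.
Qed.

Lemma dirlim_surj (x : dirlim) : exists k (a : A k), x = dirlim_in a.
Proof.
exists (tag (repr x)), (tagged (repr x)).
by rewrite /dirlim_in -[LHS]reprK; case: (repr x).
Qed.

Definition dl_op2 (op : forall k, A k -> A k -> A k) (x y : dirlim) : dirlim :=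
  let: existT k a := repr x in let: existT l b := repr y in
  dirlim_in (op (maxn k l) (dl_map (leq_maxl k l) a) (dl_map (leq_maxr k l) b)).

Definition dl_op1 (op : forall k, A k -> A k) (x : dirlim) : dirlim :=
  let: existT k a := repr x in dirlim_in (op k a).

Lemma dl_op2E (op : forall k, A k -> A k -> A k) :
    (forall k N (kN : (k <= N)%N), {morph dl_map kN : a b / op k a b >-> op N a b}) ->
  forall k, {morph @dirlim_in k : a b / op k a b >-> dl_op2 op a b}.
Proof.
move=> opM k a b; rewrite /dl_op2.
have: dirlim_in a = \pi_dirlim (repr (dirlim_in a)) by rewrite reprK.
have: dirlim_in b = \pi_dirlim (repr (dirlim_in b)) by rewrite reprK.
case: (repr (dirlim_in a)) => i a'; case: (repr (dirlim_in b)) => j b'.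
move=> /dirlim_in_eq[M [kM [jM eM]]] /dirlim_in_eq[N [kN [iN eN]]].
have [hM hN] := (leq_maxl M N, leq_maxr M N).
have kL := leq_trans kM hM; have iL := leq_trans iN hN.
have jL := leq_trans jM hM.
have hL : (maxn i j <= maxn M N)%N by rewrite geq_max iL jL.
apply/dirlim_in_eq; exists (maxn M N), kL, hL.
rewrite !opM (dl_map_comp _ _ iL) (dl_map_comp _ _ jL).
by rewrite -(dl_map_comp kN hN) eN -(dl_map_comp kM hM) eM !(dl_map_comp _ _ iL)
           !(dl_map_comp _ _ jL).
Qed.

Lemma dl_op1E (op : forall k, A k -> A k) :
    (forall k N (kN : (k <= N)%N), {morph dl_map kN : a / op k a >-> op N a}) ->
  forall k, {morph @dirlim_in k : a / op k a >-> dl_op1 op a}.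
Proof.
move=> opM k a; rewrite /dl_op1.
have: dirlim_in a = \pi_dirlim (repr (dirlim_in a)) by rewrite reprK.
case: (repr (dirlim_in a)) => i a' /dirlim_in_eq[N [kN [iN eN]]].
by apply/dirlim_in_eq; exists N, kN, iN; rewrite !opM eN.
Qed.

Definition dl_add := dl_op2 (fun k => +%R).
Definition dl_mul := dl_op2 (fun k => *%R).
Definition dl_opp := dl_op1 (fun k => -%R).
Definition dl_zero := dirlim_in (0 : A 0).
Definition dl_one := dirlim_in (1 : A 0).

Lemma dl_addE k : {morph @dirlim_in k : a b / a + b >-> dl_add a b}.
Proof. by apply: (@dl_op2E (fun k => +%R)) => l N lN a b; rewrite rmorphD. Qed.
Lemma dl_mulE k : {morph @dirlim_in k : a b / a * b >-> dl_mul a b}.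
Proof. by apply: (@dl_op2E (fun k => *%R)) => l N lN a b; rewrite rmorphM. Qed.
Lemma dl_oppE k : {morph @dirlim_in k : a / - a >-> dl_opp a}.
Proof. by apply: (@dl_op1E (fun k => -%R)) => l N lN a; rewrite rmorphN. Qed.
Lemma dl_zeroE k : dl_zero = dirlim_in (0 : A k).
Proof. by rewrite /dl_zero -(dirlim_in_map (leq0n k)) rmorph0. Qed.
Lemma dl_oneE k : dl_one = dirlim_in (1 : A k).
Proof. by rewrite /dl_one -(dirlim_in_map (leq0n k)) rmorph1. Qed.

Lemma dirlim_surj2 (x y : dirlim) :
  exists k (a b : A k), x = dirlim_in a /\ y = dirlim_in b.
Proof.
have [i [a ->]] := dirlim_surj x; have [j [b ->]] := dirlim_surj y.
exists (maxn i j), (dl_map (leq_maxl i j) a), (dl_map (leq_maxr i j) b).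
by rewrite !dirlim_in_map.
Qed.

Lemma dirlim_surj3 (x y z : dirlim) :
  exists k (a b c : A k),
    [/\ x = dirlim_in a, y = dirlim_in b & z = dirlim_in c].
Proof.
have [i [a [b [-> ->]]]] := dirlim_surj2 x y; have [j [c ->]] := dirlim_surj z.
exists (maxn i j), (dl_map (leq_maxl i j) a), (dl_map (leq_maxl i j) b),
  (dl_map (leq_maxr i j) c).
by rewrite !dirlim_in_map.
Qed.

Lemma dl_addA : associative dl_add.
Proof.
move=> x y z; have [k [a [b [c [-> -> ->]]]]] := dirlim_surj3 x y z.
by rewrite -!dl_addE addrA.
Qed.
Lemma dl_addC : commutative dl_add.
Proof.
move=> x y; have [k [a [b [-> ->]]]] := dirlim_surj2 x y.
by rewrite -!dl_addE addrC.
Qed.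
Lemma dl_add0 : left_id dl_zero dl_add.
Proof.
by move=> x; have [k [a ->]] := dirlim_surj x; rewrite (dl_zeroE k) -dl_addE add0r.
Qed.
Lemma dl_addN : left_inverse dl_zero dl_opp dl_add.
Proof.
move=> x; have [k [a ->]] := dirlim_surj x.
by rewrite -dl_oppE -dl_addE addNr -dl_zeroE.
Qed.
Lemma dl_mulA : associative dl_mul.
Proof.
move=> x y z; have [k [a [b [c [-> -> ->]]]]] := dirlim_surj3 x y z.
by rewrite -!dl_mulE mulrA.
Qed.
Lemma dl_mul1l : left_id dl_one dl_mul.
Proof.
by move=> x; have [k [a ->]] := dirlim_surj x; rewrite (dl_oneE k) -dl_mulE mul1r.
Qed.
Lemma dl_mul1r : right_id dl_one dl_mul.
Proof.
by move=> x; have [k [a ->]] := dirlim_surj x; rewrite (dl_oneE k) -dl_mulE mulr1.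
Qed.
Lemma dl_mulDl : left_distributive dl_mul dl_add.
Proof.
move=> x y z; have [k [a [b [c [-> -> ->]]]]] := dirlim_surj3 x y z.
by rewrite -!(dl_addE, dl_mulE) mulrDl.
Qed.
Lemma dl_mulDr : right_distributive dl_mul dl_add.
Proof.
move=> x y z; have [k [a [b [c [-> -> ->]]]]] := dirlim_surj3 x y z.
by rewrite -!(dl_addE, dl_mulE) mulrDr.
Qed.

HB.instance Definition _ :=
  GRing.isZmodule.Build dirlim dl_addA dl_addC dl_add0 dl_addN.
HB.instance Definition _ :=
  GRing.Zmodule_isPzRing.Build dirlim dl_mulA dl_mul1l dl_mul1r
    dl_mulDl dl_mulDr.

Lemma dirlim_in_is_zmod k : zmod_morphism (@dirlim_in k).
Proof. by move=> a b; rewrite dl_addE dl_oppE. Qed.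
Lemma dirlim_in_is_monoid k : monoid_morphism (@dirlim_in k).
Proof. by split=> [|a b]; [rewrite -dl_oneE | rewrite dl_mulE]. Qed.

HB.instance Definition _ k :=
  GRing.isZmodMorphism.Build (A k) dirlim (@dirlim_in k) (@dirlim_in_is_zmod k).
HB.instance Definition _ k :=
  GRing.isMonoidMorphism.Build (A k) dirlim (@dirlim_in k)
    (@dirlim_in_is_monoid k).

Lemma dirlim_universal (S : pzRingType) (g : forall k, {rmorphism A k -> S}) :
    (forall k (a : A k), g k.+1 (f k a) = g k a) ->
  exists h : {rmorphism dirlim -> S},
    (forall k (a : A k), h (dirlim_in a) = g k a) /\
    (forall h' : {rmorphism dirlim -> S},
       (forall k (a : A k), h' (dirlim_in a) = g k a) -> h' =1 h).
Proof.
move=> gf.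
have gmap k N (kN : (k <= N)%N) (a : A k) : g N (dl_map kN a) = g k a.
  elim: N => [|N IHN] in kN *.
    have k0 : k = 0%N by case: k kN a.
    by subst k; rewrite dl_map_id.
  have [lt_kN|defk] := leqS_or kN.
    by rewrite (@dl_mapS _ N lt_kN) gf IHN.
  by subst k; rewrite dl_map_id.
pose h (x : dirlim) : S := g (tag (repr x)) (tagged (repr x)).
have hE k (a : A k) : h (dirlim_in a) = g k a.
  have: dirlim_in a = \pi_dirlim (repr (dirlim_in a)) by rewrite reprK.
  rewrite /h; case: (repr (dirlim_in a)) => i b /dirlim_in_eq[N [kN [iN e]]].
  by rewrite -(gmap _ _ iN) /= -e gmap.
have hZ : zmod_morphism h.
  move=> x y; have [k [a [b [-> ->]]]] := dirlim_surj2 x y.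
  by rewrite -rmorphB !hE rmorphB.
have hM : monoid_morphism h.
  split=> [|x y]; first by rewrite -(rmorph1 (@dirlim_in 0)) hE rmorph1.
  have [k [a [b [-> ->]]]] := dirlim_surj2 x y.
  by rewrite -rmorphM !hE rmorphM.
pose hz := GRing.isZmodMorphism.Build _ _ h hZ.
pose hm := GRing.isMonoidMorphism.Build _ _ h hM.
pose hr : {rmorphism dirlim -> S} := HB.pack h hz hm.
exists hr; split=> [|h' h'E x]; first exact: hE.
by have [k [a ->]] := dirlim_surj x; rewrite h'E -hE.
Qed.

End DirectLimit.

Section MatricialClosure.
Variables (n : nat) (R : nzRingType).

Lemma sum_expnS k : (\sum_(i < n) n ^ k = n ^ k.+1)%N.
Proof. by rewrite sum_nat_const card_ord expnS. Qed.

Definition mc_step k (M : 'M[R]_(n ^ k)) : 'M[R]_(n ^ k.+1) :=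
  castmx (sum_expnS k, sum_expnS k) (\mxdiag_(i < n) M).

Lemma mc_step_is_zmod k : zmod_morphism (@mc_step k).
Proof.
move=> M N; rewrite /mc_step mxdiagB.
by case: _ / (sum_expnS k); rewrite !castmx_id.
Qed.

Lemma mc_step_is_monoid k : monoid_morphism (@mc_step k).
Proof.
rewrite /mc_step; case: _ / (sum_expnS k); split=> [|M N]; rewrite !castmx_id.
  exact: mxdiagZ.
rewrite -[RHS]/(_ *m _) /mxdiag mul_mxdiag_mxblock.
apply/eq_mxblockP => i j.
by case: eqP => [e|_]; rewrite ?mulmx0 //; subst j; rewrite !conform_mx_id.
Qed.

HB.instance Definition _ k :=
  GRing.isZmodMorphism.Build 'M[R]_(n ^ k) 'M[R]_(n ^ k.+1) (@mc_step k)
    (@mc_step_is_zmod k).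
HB.instance Definition _ k :=
  GRing.isMonoidMorphism.Build 'M[R]_(n ^ k) 'M[R]_(n ^ k.+1) (@mc_step k)
    (@mc_step_is_monoid k).

Lemma mc_step_inj k : (0 < n)%N -> injective (@mc_step k).
Proof.
move=> n_gt0 M N; rewrite /mc_step.
case: _ / (sum_expnS k); rewrite !castmx_id => /eq_mxdiagP.
by move/(_ (Ordinal n_gt0)).
Qed.

(* 'M[R]_(n ^ 0) = 'M[R]_1 plays the role of R at stage 0. *)
Definition matricial_closure : pzRingType :=
  dirlim (A := fun k => 'M[R]_(n ^ k)) (fun k => @mc_step k).

End MatricialClosure.

(* Main.v *)
Require Import Defs.
From mathcomp Require Import all_boot all_order all_algebra.

(** Regularity passes to direct limits because any element and a
    quasi-inverse of it live at a common finite stage, so it suffices to show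
    that matrices over a regular ring are regular.  For this, rectangular
    matrices are built up from 1 x 1 ones by adjoining rows and columns: if X
    is a quasi-inverse of the block A1 of A = [A1 A2] and Y stacks X on 0, then
    A - A Y A = [0 (1 - A1 X) A2] has fewer nonzero columns, and a
    quasi-inverse of A - A Y A yields one of A. *)

Import GRing.Theory.
Local Open Scope ring_scope.

Definition regular_mx {R : pzRingType} {m n} (A : 'M[R]_(m, n)) : Prop :=
  exists X : 'M[R]_(n, m), A = A *m X *m A.

Section RegularMatrices.
Variable R : pzRingType.

(** The defect [B] factors both as [A (1 - Y A)] and as [(1 - A Y) A], so [B = B X B] reads
    [A - A Y A = A ((1 - Y A) X (1 - A Y)) A]. *)
Lemma regular_mx_defect m n (A : 'M[R]_(m, n)) (Y : 'M[R]_(n, m)) :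
  regular_mx (A - A *m Y *m A) -> regular_mx A.
Proof.
case=> X defB; exists (Y + (1%:M - Y *m A) *m X *m (1%:M - A *m Y)).
have defBl : A *m (1%:M - Y *m A) = A - A *m Y *m A.
  by rewrite mulmxBr mulmx1 mulmxA.
have defBr : (1%:M - A *m Y) *m A = A - A *m Y *m A.
  by rewrite mulmxBl mul1mx.
rewrite (mulmxDr A Y) (mulmxDl (A *m Y)) !mulmxA defBl -[_ *m A in X in _ + X]mulmxA defBr.
by rewrite -defB addrC subrK.
Qed.

Lemma regular_row_mx m n1 n2 :
    (forall A : 'M[R]_(m, n1), regular_mx A) ->
    (forall A : 'M[R]_(m, n2), regular_mx A) ->
  forall A : 'M[R]_(m, n1 + n2), regular_mx A.
Proof.
move=> reg1 reg2 A; rewrite -[A]hsubmxK.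
move: (lsubmx A) (rsubmx A) => A1 A2; have [X defA1] := reg1 A1.
apply: (regular_mx_defect _ _ _ (col_mx X 0)).
rewrite mul_row_col mulmx0 addr0 mul_mx_row -defA1 opp_row_mx add_row_mx subrr.
move: (A2 - _) => C; have [Z defC] := reg2 C; exists (col_mx 0 Z).
by rewrite mul_row_col mulmx0 add0r mul_mx_row mulmx0 -defC.
Qed.

(** Transposing [regular_row_mx] would land in the opposite ring, so the argument is redone with the
    defect [(A2 - A2 X A1)] below a zero block. *)
Lemma regular_col_mx m1 m2 n :
    (forall A : 'M[R]_(m1, n), regular_mx A) ->
    (forall A : 'M[R]_(m2, n), regular_mx A) ->
  forall A : 'M[R]_(m1 + m2, n), regular_mx A.
Proof.
move=> reg1 reg2 A; rewrite -[A]vsubmxK.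
move: (usubmx A) (dsubmx A) => A1 A2; have [X defA1] := reg1 A1.
apply: (regular_mx_defect _ _ _ (row_mx X 0)).
rewrite -mulmxA mul_row_col mul0mx addr0 mul_col_mx (mulmxA A1) -defA1.
rewrite opp_col_mx add_col_mx subrr.
move: (A2 - _) => C; have [Z defC] := reg2 C; exists (row_mx 0 Z).
by rewrite -mulmxA mul_row_col mul0mx add0r mul_col_mx mul0mx mulmxA -defC.
Qed.

Lemma regular_matrix m n (A : 'M[R]_(m, n)) :
  von_neumann_regular R -> regular_mx A.
Proof.
move=> regR; elim: n A => [|n IHn] A; first by exists 0; rewrite !thinmx0.
apply: (regular_row_mx m 1 n) => // {IHn}A.
elim: m A => [|m IHm] A; first by exists 0; rewrite !flatmx0.
apply: (regular_col_mx 1 m 1) => // {IHm}A.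
have [x defA] := regR (A 0 0); exists x%:M.
by rewrite [A]mx11_scalar -!scalar_mxM -defA.
Qed.

End RegularMatrices.

Lemma von_neumann_regular_dirlim (A : nat -> pzRingType)
    (f : forall k, {rmorphism A k -> A k.+1}) :
  (forall k, von_neumann_regular (A k)) -> von_neumann_regular (dirlim f).
Proof.
move=> regA u; have [k [a ->]] := dirlim_surj u.
have [x defa] := regA k a; exists (dirlim_in f x).
by rewrite -!rmorphM -defa.
Qed.

Theorem proposition27 (n : nat) (R : nzRingType) (n_gt0 : (0 < n)%N) :
  von_neumann_regular R -> von_neumann_regular (matricial_closure n R).
Proof.
(* On square matrices the ring product is [*m], so regularity at stage [k] is [regular_mx] by
   conversion. *)
by move=> regR; apply: von_neumann_regular_dirlim => k A; apply: regular_matrix.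
Qed.
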